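(* Let $L_r$ be the linear functional for the type $R_I$ $q$-Lommel polynomials $r_n(x;c,q)$. Then, as formal power series in $z$, $$\sum_{n=0}^\infty L_r(x^n)z^n=\frac{{}_1\phi_1(0;cq;q,qz)}{{}_1\phi_1(0;c;q,z)}=\cfrac{1}{1-b_0z-\cfrac{a_1z}{1-b_1z-\cfrac{a_2z}{1-b_2z-\cdots}}},$$ where $$a_n=\frac{cq^{2n-1}}{(1-cq^{n-1})(1-cq^n)},\qquad b_n=\frac{q^n}{1-cq^n}.$$
   Context: $c,q$ are indeterminates; all series are formal power series in $z$ over $\mathbb{Q}(c,q)$, and the infinite continued fraction is the limit of its truncations. With $(a;q)_n=\prod_{i=0}^{n-1}(1-aq^i)$, $${}_1\phi_1(0;c;q,z)=\sum_{n\ge0}\frac{(-1)^nq^{\binom n2}}{(q;q)_n(c;q)_n}z^n .$$ The type $R_I$ $q$-Lommel polynomials are defined by $r_{-1}=0$, $r_0=1$, $r_{n+1}(x;c,q)=(x-b_n)r_n(x;c,q)-x\,a_nr_{n-1}(x;c,q)$ for $n\ge0$, with $a_n,b_n$ as in the statement. $L_r$ is the normalized type $R_I$ orthogonality functional: the linear functional on Laurent polynomials in $x$ with $L_r(1)=1$ and $L_r(x^{-j}r_n(x;c,q))=0$ for $1\le j\le n$. It is known that its values on polynomials are determined by $L_r(r_n(x;c,q))=a_1a_2\cdots a_n$ for $n\ge0$. *)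

(* Defs.v *)
From HB Require Import structures.
From mathcomp Require Import all_boot all_order all_algebra.
From mathcomp Require Import mpoly freeg.

Set Implicit Arguments.
Unset Strict Implicit.
Unset Printing Implicit Defensive.

Import GRing.Theory.
Local Open Scope ring_scope.

Definition Qcq : fieldType := {fraction {mpoly rat[2]}}.
Definition cvar : Qcq := tofrac ('X_0 : {mpoly rat[2]}).
Definition qvar : Qcq := tofrac ('X_1 : {mpoly rat[2]}).

(* A formal power series in z is its coefficient sequence; series are compared
   coefficientwise, with =1. *)
Definition fps (F : fieldType) : Type := nat -> F.

Section FormalPowerSeries.
Variable F : fieldType.
Implicit Types f g : fps F.

Definition fps_one : fps F := fun n => (n == 0%N)%:R.

(* The series u z. *)
Definition fps_Z (u : F) : fps F := fun n => if n == 1%N then u else 0.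

Definition fps_sub f g : fps F := fun n => f n - g n.

Definition fps_mul f g : fps F := fun n => \sum_(i < n.+1) f i * g (n - i)%N.

(* fps_inv_seq f n lists the coefficients 0, ..., n of 1 / f. *)
Fixpoint fps_inv_seq f (n : nat) : seq F :=
  if n is m.+1 then
    let s := fps_inv_seq f m in
    rcons s (- (f 0%N)^-1 * \sum_(i < m.+1) s`_i * f (m.+1 - i)%N)
  else [:: (f 0%N)^-1].

(* Meaningful when f 0 != 0: see fps_mulVf. *)
Definition fps_inv f : fps F := fun n => (fps_inv_seq f n)`_n.

Definition fps_div f g : fps F := fps_mul f (fps_inv g).

(* f(u z) *)
Definition fps_dilate (u : F) f : fps F := fun n => u ^+ n * f n.

(* Convergence in the z-adic topology. *)
Definition fps_cvg (s : nat -> fps F) f : Prop :=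
  forall m, exists N, forall n, (N <= n)%N -> s n m = f m.

Lemma size_fps_inv_seq f n : size (fps_inv_seq f n) = n.+1.
Proof. by elim: n => //= n IHn; rewrite size_rcons IHn. Qed.

Lemma nth_fps_inv_seq f n i : (i <= n)%N -> (fps_inv_seq f n)`_i = fps_inv f i.
Proof.
elim: n => [|n IHn]; first by case: i.
rewrite leq_eqVlt => /predU1P[->//|]; rewrite ltnS => lein.
by rewrite /= nth_rcons size_fps_inv_seq ltnS lein IHn.
Qed.

Lemma fps_mulVf f : f 0%N != 0 -> fps_mul (fps_inv f) f =1 fps_one.
Proof.
move=> f0 [|n]; first by rewrite /fps_mul big_ord1 /fps_inv /= mulVf.
rewrite /fps_mul big_ord_recr /= subnn {2}/fps_inv /=.
rewrite nth_rcons size_fps_inv_seq ltnn eqxx.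
under [X in - _ * X]eq_bigr => i _
  do rewrite (nth_fps_inv_seq _ (leq_ord i)).
by rewrite mulrC mulrA mulrN mulfV // mulN1r subrr.
Qed.

End FormalPowerSeries.

Section LaurentPolynomials.
Variable F : fieldType.

(* Laurent polynomials in x, as the F-vector space with basis << k >> = x^k,
   k : int. *)
Definition laurent : lmodType F := {freeg int / F}.

(* x^k p(x) *)
Definition xshift (k : int) (p : {poly F}) : laurent :=
  \sum_(i < size p) << p`_i *g k + i%:Z >>.

End LaurentPolynomials.

Section TypeRI.
Variable F : fieldType.
Implicit Types a b : nat -> F.

(* The pair (r_{n-1}, r_n). *)
Fixpoint typeRI_pair a b (n : nat) : {poly F} * {poly F} :=
  if n is m.+1 then
    let: (r', r) := typeRI_pair a b m in
    (r, ('X - (b m)%:P) * r - 'X * (a m *: r'))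
  else (0, 1).

Definition typeRI_poly a b (n : nat) : {poly F} := (typeRI_pair a b n).2.

Definition typeRI_functional (r : nat -> {poly F}) (L : {scalar laurent F}) :
    Prop :=
  L << 0 >> = 1 /\
  forall j n : nat, (1 <= j <= n)%N -> L (xshift (- j%:Z) (r n)) = 0.

Definition moment_series (L : {scalar laurent F}) : fps F :=
  fun n => L << n%:Z >>.

(* 1 - b_n z - a_{n+1} z / (1 - b_{n+1} z - ... - a_{n+k} z / (1 - b_{n+k} z)) *)
Fixpoint cf_tail a b (n k : nat) : fps F :=
  let head := fps_sub (fps_one F) (fps_Z (b n)) in
  if k is k'.+1 then
    fps_sub head (fps_div (fps_Z (a n.+1)) (cf_tail a b n.+1 k'))
  else head.

Definition cf_trunc a b (N : nat) : fps F :=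
  fps_div (fps_one F) (cf_tail a b 0 N).

End TypeRI.

Section QSeries.
Variable F : fieldType.

Definition qpoch (a q : F) (n : nat) : F := \prod_(i < n) (1 - a * q ^+ i).

(* 1phi1(0; c; q, z) *)
Definition phi11 (c q : F) : fps F := fun n =>
  (-1) ^+ n * q ^+ 'C(n, 2) / (qpoch q q n * qpoch c q n).

(* The exponents 2n - 1 and n - 1 are integers: they are negative at n = 0. *)
Definition lommel_a (c q : F) (n : nat) : F :=
  c * q ^ (2 * n%:Z - 1) / ((1 - c * q ^ (n%:Z - 1)) * (1 - c * q ^+ n)).

Definition lommel_b (c q : F) (n : nat) : F := q ^+ n / (1 - c * q ^+ n).

Definition qlommel (c q : F) : nat -> {poly F} :=
  typeRI_poly (lommel_a c q) (lommel_b c q).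

End QSeries.

(* Main.v *)
Require Import Defs.
From mathcomp Require Import all_boot all_order all_algebra.
From mathcomp Require Import mpoly freeg ring.

Set Implicit Arguments.
Unset Strict Implicit.
Unset Printing Implicit Defensive.

Import GRing.Theory.
Local Open Scope ring_scope.

(** Both equalities come from one contiguous relation.  Put
    G_n(z) = 1phi1(0; c q^n; q, q^n z), so that the right-hand ratio is G_1 / G_0.
    Comparing coefficients of z gives
      G_n = (1 - b_n z) G_(n+1) - a_(n+1) z G_(n+2)
    ([phi11_contiguous]), and G_n(0) = 1.

    Continued fraction.  The relation reads
      G_n / G_(n+1) = 1 - b_n z - a_(n+1) z / (G_(n+1) / G_(n+2)),
    which is the recursion of the tails of the fraction.  Each level multiplies
    the error by z, so the tail of depth k started at n agrees with
    G_n / G_(n+1) modulo z^(k+1) ([cf_tail_contiguous]); hence convergence.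

    Moments.  Let M_n(z) be the generating series of the L(x^k r_n), k >= 0.
    The recurrence of the r_n, applied to L, is a recurrence of the same shape
    for the M_n.  For n >= 1 its inhomogeneous terms cancel because orthogonality,
    L(x^(-1) r_n) = L(x^(-1) r_(n+1)) = 0, gives L(r_n) = a_n L(r_(n-1)); for
    n = 0 the term L(1) = 1 remains.  The recurrence is
    also satisfied by the series L(r_n) G_(n+1) / G_0, and its only solution is
    found coefficient by coefficient, so M_n G_0 = L(r_n) G_(n+1)
    ([moment_mul_contiguous]); n = 0 is the claim.

    Both arguments work for all coefficients a, b over any field and any
    solution G of the contiguous relation with G_n(0) = 1.  Only the contiguous
    relation itself is about q-series, and it holds as soon as no 1 - q^(i+1)
    and no 1 - c q^i vanishes. *)

(** * Power series up to a given order *)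

Section TruncatedEquality.
Variable F : fieldType.
Implicit Types (f g h : fps F) (u : F) (k m : nat).

Definition fps_eqmod k f g : Prop := forall m, (m < k)%N -> f m = g m.

Lemma fps_eqmodP f g : (forall k, fps_eqmod k f g) -> f =1 g.
Proof. by move=> fg m; exact: (fg m.+1). Qed.

Lemma eq_fps_eqmod k f g : f =1 g -> fps_eqmod k f g.
Proof. by move=> fg m _; exact: fg. Qed.

Lemma fps_eqmod_sym k f g : fps_eqmod k f g -> fps_eqmod k g f.
Proof. by move=> fg m ltmk; rewrite fg. Qed.

Lemma fps_eqmod_trans k g f h :
  fps_eqmod k f g -> fps_eqmod k g h -> fps_eqmod k f h.
Proof. by move=> fg gh m ltmk; rewrite fg ?gh. Qed.

Lemma fps_mul_eqmod k f f' g g' :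
  fps_eqmod k f f' -> fps_eqmod k g g' ->
  fps_eqmod k (fps_mul f g) (fps_mul f' g').
Proof.
move=> ff' gg' m ltmk; apply: eq_bigr => i _.
rewrite ff' ?gg' //; first exact: leq_ltn_trans (leq_subr _ _) ltmk.
exact: leq_ltn_trans (leq_ord i) ltmk.
Qed.

(** Low-order coefficients of a product are those of a product of polynomials,
    which transports commutativity and associativity from [{poly F}]. *)
Lemma fps_mul_coef_poly k f g m : (m < k)%N ->
  fps_mul f g m = (\poly_(i < k) f i * \poly_(i < k) g i)`_m.
Proof.
move=> ltmk; rewrite coefM; apply: eq_bigr => i _; rewrite !coef_poly.
rewrite (leq_ltn_trans (leq_ord i) ltmk).
by rewrite (leq_ltn_trans (leq_subr _ _) ltmk).
Qed.

Lemma fps_mulC f g : fps_mul f g =1 fps_mul g f.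
Proof. by move=> m; rewrite !(@fps_mul_coef_poly m.+1) // mulrC. Qed.

Lemma fps_mulA f g h :
  fps_mul f (fps_mul g h) =1 fps_mul (fps_mul f g) h.
Proof.
move=> m; pose T f := \poly_(i < m.+1) f i.
have TM f1 f2 i : (i < m.+1)%N -> (T (fps_mul f1 f2))`_i = (T f1 * T f2)`_i.
  by move=> lti; rewrite /T coef_poly lti; exact: fps_mul_coef_poly.
rewrite !(@fps_mul_coef_poly m.+1) // -/(T _) -/(T (fps_mul f g)) -!/(T _).
transitivity (T f * (T g * T h))`_m.
  rewrite !coefM; apply: eq_bigr => i _.
  by rewrite TM // ltnS leq_subr.
rewrite mulrA !coefM; apply: eq_bigr => i _.
by rewrite TM.
Qed.

Lemma fps_mul1 f : fps_mul (fps_one F) f =1 f.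
Proof.
move=> m; rewrite /fps_mul big_ord_recl /= /fps_one eqxx mul1r subn0.
by rewrite big1 ?addr0 // => i _; rewrite mul0r.
Qed.

Lemma fps_mulZ0 u f : fps_mul (fps_Z u) f 0 = 0.
Proof. by rewrite /fps_mul big_ord1 mul0r. Qed.

Lemma fps_mulZS u f m : fps_mul (fps_Z u) f m.+1 = u * f m.
Proof.
rewrite /fps_mul 2!big_ord_recl /= /fps_Z /= mul0r add0r subSS subn0.
by rewrite big1 ?addr0 // => i _; rewrite mul0r.
Qed.

Lemma fps_mulBl f g h :
  fps_mul (fps_sub f g) h =1 fps_sub (fps_mul f h) (fps_mul g h).
Proof.
move=> m; rewrite /fps_sub /fps_mul -sumrB.
by apply: eq_bigr => i _; rewrite mulrBl.
Qed.

Lemma fps_mulfV f : f 0%N != 0 -> fps_mul f (fps_inv f) =1 fps_one F.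
Proof. by move=> f0 m; rewrite fps_mulC fps_mulVf. Qed.

Lemma fps_mulr1_eq f g : g =1 fps_one F -> fps_mul f g =1 f.
Proof.
move=> g1 m; rewrite fps_mulC -[RHS]fps_mul1.
by apply: (@fps_mul_eqmod m.+1) => // i _; rewrite g1.
Qed.

Lemma fps_divK f g : g 0%N != 0 -> fps_mul (fps_div f g) g =1 f.
Proof.
move=> g0 m; rewrite /fps_div -fps_mulA.
exact: fps_mulr1_eq (fps_mulVf g0) m.
Qed.

(** Division is characterised by multiplication at every truncation order, so
    the arguments below never have to look inside [fps_inv]. *)
Lemma fps_eqmod_div k f g h : f 0%N != 0 ->
  fps_eqmod k (fps_mul g f) h -> fps_eqmod k g (fps_div h f).
Proof.
move=> f0 gfh; apply: (@fps_eqmod_trans k (fps_div (fps_mul g f) f)).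
  apply: eq_fps_eqmod => m; rewrite /fps_div -fps_mulA.
  by rewrite (fps_mulr1_eq _ (fps_mulfV f0)).
exact: fps_mul_eqmod.
Qed.

Lemma eq_fps_div f g g' : g 0%N != 0 -> g =1 g' -> fps_div f g =1 fps_div f g'.
Proof.
move=> g0 gg'; apply: fps_eqmodP => k; apply: fps_eqmod_div; first by rewrite -gg'.
apply: (@fps_eqmod_trans k (fps_mul (fps_div f g) g)).
  by apply: fps_mul_eqmod => // m _; rewrite gg'.
exact/eq_fps_eqmod/fps_divK.
Qed.

End TruncatedEquality.

(** * Continued fractions and contiguous relations *)

Section ContinuedFraction.
Variables (F : fieldType) (a b : nat -> F).

(** The relation G_n = (1 - b_n z) G_(n+1) - a_(n+1) z G_(n+2) on the
    coefficients of positive degree; its constant term G_n(0) = G_(n+1)(0)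
    is covered by the normalisation G_n(0) = 1 assumed alongside. *)
Definition contiguous (G : nat -> fps F) : Prop :=
  forall n m,
    G n m.+1 = G n.+1 m.+1 - b n * G n.+1 m - a n.+1 * G n.+2 m.

Lemma cf_tail0 n k : cf_tail a b n k 0%N = 1.
Proof.
have head0 : fps_sub (fps_one F) (fps_Z (b n)) 0%N = 1.
  by rewrite /fps_sub /fps_one /fps_Z subr0.
case: k => [|k] //=; rewrite {1}/fps_sub head0.
by rewrite /fps_div fps_mulZ0 subr0.
Qed.

Variable G : nat -> fps F.
Hypotheses (G0 : forall n, G n 0%N = 1) (GS : contiguous G).

(** The tail of depth k approximates G_n / G_(n+1).  Unfolding one level puts
    the approximation of G_(n+1) / G_(n+2) behind a factor z, which gains one
    order of accuracy. *)
Lemma cf_tail_contiguous k n :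
  fps_eqmod k.+1 (fps_mul (cf_tail a b n k) (G n.+1)) (G n).
Proof.
elim: k n => [|k IHk] n.
  by case=> // _; rewrite fps_mulBl /fps_sub fps_mul1 fps_mulZ0 !G0 subr0.
case=> [|m] ltmk; first by rewrite /fps_mul big_ord1 cf_tail0 !G0 mul1r.
rewrite /= fps_mulBl {1}/fps_sub fps_mulBl {1}/fps_sub fps_mul1 fps_mulZS.
rewrite /fps_div -fps_mulA fps_mulZS [RHS]GS; congr (_ - _ * _).
rewrite fps_mulC; apply/esym/(@fps_eqmod_div _ k.+1) => //.
  by rewrite cf_tail0 oner_eq0.
by move=> i ltik; rewrite fps_mulC; exact: IHk.
Qed.

Lemma cf_trunc_contiguous N :
  fps_eqmod N.+1 (cf_trunc a b N) (fps_div (G 1%N) (G 0%N)).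
Proof.
have T0 : cf_tail a b 0 N 0%N != 0 by rewrite cf_tail0 oner_eq0.
apply: fps_eqmod_div; first by rewrite G0 oner_eq0.
have GT := fps_eqmod_sym (@cf_tail_contiguous N 0).
apply: fps_eqmod_trans (fps_mul_eqmod (fun _ _ => erefl) GT) _.
apply: eq_fps_eqmod => m; rewrite fps_mulA -[RHS]fps_mul1.
by apply: (@fps_mul_eqmod _ m.+1) => // i _; exact: fps_divK.
Qed.

Lemma cf_trunc_cvg : fps_cvg (cf_trunc a b) (fps_div (G 1%N) (G 0%N)).
Proof. by move=> m; exists m => n lemn; exact: cf_trunc_contiguous. Qed.

End ContinuedFraction.

(** * Functionals on Laurent polynomials *)

Section LaurentEvaluation.
Variables (F : fieldType) (L : {scalar laurent F}).
Implicit Types (p r : {poly F}) (k : int).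

Lemma scale_freegU (u : F) k : u *: << k >> = << u *g k >> :> laurent F.
Proof.
by apply/eqP/freeg_eqP => j; rewrite coeffZ !coeffU mul1r.
Qed.

(** Allowing any bound N on the size lets polynomials of different degrees be
    expanded over one index range. *)
Lemma functional_xshift k p N : (size p <= N)%N ->
  L (xshift k p) = \sum_(i < N) p`_i * L << k + i%:Z >>.
Proof.
move=> lepN; rewrite /xshift linear_sum /=.
rewrite (big_ord_widen N (fun i => L << p`_i *g k + i%:Z >>) lepN).
rewrite [RHS](bigID (fun i : 'I_N => (i < size p)%N)) /= [X in _ + X]big1 ?addr0.
  by apply: eq_bigr => i _; rewrite -scale_freegU linearZ.
by move=> i; rewrite -leqNgt => lepi; rewrite nth_default ?mul0r.
Qed.

Lemma functional_xshiftB k p r :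
  L (xshift k (p - r)) = L (xshift k p) - L (xshift k r).
Proof.
pose N := maxn (size (p - r)) (maxn (size p) (size r)).
rewrite !(@functional_xshift k _ N) ?leq_max ?leqnn ?orbT // -sumrB.
by apply: eq_bigr => i _; rewrite coefB mulrBl.
Qed.

Lemma functional_xshiftZ k (u : F) p :
  L (xshift k (u *: p)) = u * L (xshift k p).
Proof.
rewrite !(@functional_xshift k _ (size p)) ?size_scale_leq // mulr_sumr.
by apply: eq_bigr => i _; rewrite coefZ mulrA.
Qed.

Lemma functional_xshiftX k p : L (xshift k ('X * p)) = L (xshift (k + 1) p).
Proof.
rewrite (@functional_xshift (k + 1) p (size p)) //.
rewrite (@functional_xshift k _ (size p).+1); last first.
  by apply: leq_trans (size_polyMleq _ _) _; rewrite size_polyX.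
rewrite big_ord_recl coefXM mul0r add0r; apply: eq_bigr => i _.
by rewrite coefXM /= -addrA -intS.
Qed.

Lemma functional_xshift1 k : L (xshift k 1) = L << k >>.
Proof.
by rewrite (@functional_xshift k 1 1) ?size_poly1 // big_ord1 coef1 mul1r addr0.
Qed.

End LaurentEvaluation.

(** * Moments of a type R_I functional *)

Section Moments.
Variables (F : fieldType) (a b : nat -> F) (L : {scalar laurent F}).

Lemma typeRI_polySS n :
  typeRI_poly a b n.+2 =
  ('X - (b n.+1)%:P) * typeRI_poly a b n.+1 - 'X * (a n.+1 *: typeRI_poly a b n).
Proof. by rewrite /typeRI_poly /=; case: (typeRI_pair a b n). Qed.

Lemma functional_typeRI1 k :
  L (xshift k (typeRI_poly a b 1)) = L << k + 1 >> - b 0%N * L << k >>.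
Proof.
rewrite /typeRI_poly /= scaler0 mulr0 subr0 mulrBl mul_polyC.
by rewrite functional_xshiftB functional_xshiftX functional_xshiftZ !functional_xshift1.
Qed.

Lemma functional_typeRISS k n :
  L (xshift k (typeRI_poly a b n.+2)) =
  L (xshift (k + 1) (typeRI_poly a b n.+1))
  - b n.+1 * L (xshift k (typeRI_poly a b n.+1))
  - a n.+1 * L (xshift (k + 1) (typeRI_poly a b n)).
Proof.
rewrite typeRI_polySS mulrBl mul_polyC !functional_xshiftB !functional_xshiftX.
by rewrite !functional_xshiftZ.
Qed.

Hypothesis HL : typeRI_functional (typeRI_poly a b) L.

(** The recurrence of r_(n+2) multiplied by x^(-1): two of its four terms are
    killed by orthogonality. *)
Lemma functional_typeRI_poly n :
  L (xshift 0 (typeRI_poly a b n.+1)) =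
  a n.+1 * L (xshift 0 (typeRI_poly a b n)).
Proof.
have := functional_typeRISS (-1) n.
rewrite !(HL.2 1%N) // mulr0 subr0 addNr => /esym/eqP.
by rewrite subr_eq0 => /eqP.
Qed.

Let moment n : fps F := fun k => L (xshift k%:Z (typeRI_poly a b n)).

(** The moment series times G_0 solve the same recurrence as L(r_n) G_(n+1),
    whose degree m + 1 part at index n is determined by degree m and by
    index n - 1: hence the induction on m and, inside it, on n. *)
Lemma moment_mul_contiguous (G : nat -> fps F) :
  (forall n, G n 0%N = 1) -> contiguous a b G ->
  forall n m, fps_mul (moment n) (G 0%N) m = moment n 0%N * G n.+1 m.
Proof.
move=> G0 GS n m; elim: m n => [|m IHm] n.
  by rewrite /fps_mul big_ord1 !G0.
have mulS n' : fps_mul (moment n') (G 0%N) m.+1 =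
    moment n' 0%N * G 0%N m.+1 + fps_mul (fun k => moment n' k.+1) (G 0%N) m.
  by rewrite {1}/fps_mul big_ord_recl subn0.
have posS (k : nat) : k.+1%:Z = k%:Z + 1 by rewrite intS addrC.
have A0 : moment 0 0%N = 1 by rewrite /moment functional_xshift1 HL.1.
have AS n' : moment n'.+1 0%N = a n'.+1 * moment n' 0%N.
  exact: functional_typeRI_poly.
elim: n => [|n IHn].
  rewrite mulS A0.
  have -> : fps_mul (fun k => moment 0 k.+1) (G 0%N) m =
      fps_mul (moment 1) (G 0%N) m + b 0%N * fps_mul (moment 0) (G 0%N) m.
    rewrite /fps_mul mulr_sumr -big_split; apply: eq_bigr => i _ /=.
    rewrite /moment functional_typeRI1 !functional_xshift1 posS; ring.
  rewrite !IHm AS A0 GS; ring.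
have -> : fps_mul (moment n.+1) (G 0%N) m.+1 =
    moment n.+1 0%N * G 0%N m.+1 + (fps_mul (moment n.+2) (G 0%N) m
     + b n.+1 * fps_mul (moment n.+1) (G 0%N) m
     + a n.+1 * fps_mul (fun k => moment n k.+1) (G 0%N) m).
  rewrite mulS; congr (_ + _).
  rewrite /fps_mul !mulr_sumr -!big_split; apply: eq_bigr => i _ /=.
  rewrite /moment functional_typeRISS posS; ring.
have -> : fps_mul (fun k => moment n k.+1) (G 0%N) m =
    moment n 0%N * (G n.+1 m.+1 - G 0%N m.+1).
  by rewrite mulrBr -IHn mulS addrC addKr.
rewrite !IHm !AS (GS n.+1); ring.
Qed.

Lemma moment_series_contiguous (G : nat -> fps F) :
  (forall n, G n 0%N = 1) -> contiguous a b G ->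
  moment_series L =1 fps_div (G 1%N) (G 0%N).
Proof.
move=> G0 GS; apply: fps_eqmodP => k.
apply: fps_eqmod_div => [|m _]; first by rewrite G0 oner_eq0.
have := moment_mul_contiguous G0 GS 0 m.
rewrite {2}/moment functional_xshift1 HL.1 mul1r => <-.
by apply: eq_bigr => i _; rewrite /moment functional_xshift1.
Qed.

End Moments.

(** * The contiguous relation for 1phi1 *)

Section QLommel.
Variables (F : fieldType) (c q : F).
Hypotheses (q_gen : forall i, 1 - q ^+ i.+1 != 0)
           (c_gen : forall i, 1 - c * q ^+ i != 0).

Definition phi11_chain (n : nat) : fps F :=
  fps_dilate (q ^+ n) (phi11 (c * q ^+ n) q).

Lemma phi11_chain_const n : phi11_chain n 0%N = 1.
Proof.
by rewrite /phi11_chain /fps_dilate /phi11 /qpoch !big_ord0 !expr0 !mul1r invr1.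
Qed.

Lemma qpoch_neq0 x n : (forall i, 1 - x * q ^+ i != 0) -> qpoch x q n != 0.
Proof. by move=> x_gen; apply/prodf_neq0 => i _. Qed.

Lemma qpochSr x n : qpoch x q n.+1 = qpoch x q n * (1 - x * q ^+ n).
Proof. by rewrite /qpoch big_ord_recr. Qed.

Lemma qpochSl x n : qpoch x q n.+1 = (1 - x) * qpoch (x * q) q n.
Proof.
rewrite /qpoch big_ord_recl /= expr0 mulr1; congr (_ * _).
by apply: eq_bigr => i _; rewrite exprS mulrA.
Qed.

(** Shifting n replaces (c, z) by (c q^n, q^n z), so with C = c q^n this is the
    case n = 0 for C, up to a power of q^n.  Dividing the coefficients of
    z^(m+1) by their common q-Pochhammer factors leaves a rational identity in
    C, q and q^m. *)
Lemma phi11_contiguous :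
  contiguous (lommel_a c q) (lommel_b c q) phi11_chain.
Proof.
move=> n m; rewrite /phi11_chain /fps_dilate /phi11 /lommel_a /lommel_b.
have -> : q ^ (2 * n.+1%:Z - 1) = q ^+ n * (q ^+ n * q).
  have -> : 2 * n.+1%:Z - 1 = (n + n.+1)%N%:Z by rewrite PoszD intS; ring.
  by rewrite -exprnP exprD exprSr.
have -> : q ^ (n.+1%:Z - 1) = q ^+ n.
  by have -> : n.+1%:Z - 1 = n%:Z by rewrite intS; ring.
set C := c * q ^+ n.
have EC1 : c * q ^+ n.+1 = C * q by rewrite exprSr mulrA.
have EC2 : c * q ^+ n.+2 = C * q * q by rewrite exprSr mulrA EC1.
have C_gen i : 1 - C * q ^+ i != 0 by rewrite /C -mulrA -exprD.
have C0 : 1 - C != 0 by rewrite -[C]mulr1 (C_gen 0%N).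
have C1 : 1 - C * q != 0 := C_gen 1%N.
have Cm := C_gen m.+1.
have PC : qpoch (C * q) q m != 0.
  by apply: qpoch_neq0 => i; rewrite -mulrA -exprS.
have Pq : qpoch q q m != 0.
  by apply: qpoch_neq0 => i; rewrite -exprS.
have qm := q_gen m.
(* The three base parameters C, C q, C q^2 are all expressed by qpoch (C q). *)
have ECqq : qpoch (C * q * q) q m =
    qpoch (C * q) q m * (1 - C * q ^+ m.+1) / (1 - C * q).
  by apply: (mulfI C1); rewrite -qpochSl qpochSr exprS [RHS]mulrC divfK // !mulrA.
rewrite (mulrA c) -/C EC1 EC2 ECqq (qpochSl C) !qpochSr binS bin1.
rewrite (exprS (-1)) exprD !(exprSr q) !exprMn (exprSr (q ^+ n)).
move: Cm qm; rewrite !(exprSr q).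
move: (q ^+ n) (q ^+ m) (qpoch _ q m) PC (qpoch _ q m) Pq => y x P PC P' Pq.
move: C C0 C1 {C_gen EC1 EC2 ECqq} => C C0 C1.
move: (y ^+ m) (q ^+ _) ((-1) ^+ m) => w s e Cm qm.
by field; rewrite C1 Cm PC Pq C0 mulrC qm.
Qed.

Lemma phi11_chain_0 : phi11_chain 0 =1 phi11 c q.
Proof.
by move=> m; rewrite /phi11_chain /fps_dilate !expr0 mulr1 expr1n mul1r.
Qed.

Let ratio : fps F := fps_div (fps_dilate q (phi11 (c * q) q)) (phi11 c q).

Let chain_ratio : fps_div (phi11_chain 1) (phi11_chain 0) =1 ratio.
Proof.
apply: eq_fps_div phi11_chain_0.
by rewrite phi11_chain_const oner_eq0.
Qed.

Lemma qlommel_moment_series (L : {scalar laurent F}) :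
  typeRI_functional (qlommel c q) L -> moment_series L =1 ratio.
Proof.
move=> HL m; rewrite -chain_ratio.
exact: (moment_series_contiguous HL phi11_chain_const phi11_contiguous).
Qed.

Lemma qlommel_cf_trunc_cvg :
  fps_cvg (cf_trunc (lommel_a c q) (lommel_b c q)) ratio.
Proof.
move=> m; have [N cvgN] := cf_trunc_cvg phi11_chain_const phi11_contiguous m.
by exists N => n leNn; rewrite cvgN.
Qed.

End QLommel.

(** * The indeterminates c and q *)

(** The denominators 1 - q^(i+1) and 1 - c q^i all take the value 1 at
    c = q = 0, which shows at once that they are nonzero. *)
Lemma tofrac_neq0_at0 (p : {mpoly rat[2]}) :
  p.@[fun=> 0] != 0 -> tofrac p != 0.
Proof.
by move=> p0; rewrite tofrac_eq0; apply: contraNneq p0 => ->; rewrite meval0.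
Qed.

Lemma qvar_generic i : 1 - qvar ^+ i.+1 != 0.
Proof.
rewrite -tofrac1 -tofracXn -tofracB; apply: tofrac_neq0_at0.
by rewrite mevalB meval1 exprS mevalM mevalXU mul0r subr0 oner_eq0.
Qed.

Lemma cvar_generic i : 1 - cvar * qvar ^+ i != 0.
Proof.
rewrite -tofrac1 -tofracXn -tofracM -tofracB; apply: tofrac_neq0_at0.
by rewrite mevalB meval1 mevalM mevalXU mul0r subr0 oner_eq0.
Qed.

Theorem theorem5p5 (L : {scalar laurent Qcq})
    (HL : typeRI_functional (qlommel cvar qvar) L) :
  let ratio := fps_div (fps_dilate qvar (phi11 (cvar * qvar) qvar))
                       (phi11 cvar qvar) in
  moment_series L =1 ratio /\
  fps_cvg (cf_trunc (lommel_a cvar qvar) (lommel_b cvar qvar)) ratio.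
Proof.
split; first exact: qlommel_moment_series qvar_generic cvar_generic _ HL.
exact: qlommel_cf_trunc_cvg qvar_generic cvar_generic.
Qed.
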